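(* Let $\Omega\subset\mathbb{H}_s^n$ be self-stem-preserving and let $f:\Omega\to\mathbb{H}$ be a function. Then $f$ is path-slice if and only if the formula $$F_{\Omega}^f(\gamma) = \begin{pmatrix} 1 & I \\ 1 & J \end{pmatrix}^{-1} \begin{pmatrix} f(\gamma^I(1)) \\ f(\gamma^J(1)) \end{pmatrix},\qquad \gamma\in\mathscr{P}(\mathbb{C}^n,\Omega),$$ where $I,J$ are arbitrary elements of $\mathbb{S}(\Omega,\gamma)$ with $I\neq J$, gives a well-defined function $F_\Omega^f:\mathscr{P}(\mathbb{C}^n,\Omega)\to\mathbb{H}^{2\times 1}$ (i.e. the value does not depend on the choice of $I\ne J$) and this function is the unique path-slice stem function of $f$.
   Context: Let $n$ be a positive integer, $\mathbb{H}$ the quaternions, $\mathbb{S}:=\{I\in\mathbb{H}: I^2=-1\}$, $\mathbb{C}_I:=\mathbb{R}+\mathbb{R}I$, $\mathbb{C}_I^n:=(\mathbb{C}_I)^n$ and $\mathbb{H}_s^n:=\bigcup_{I\in\mathbb{S}}\mathbb{C}_I^n\subset\mathbb{H}^n$. For $I\in\mathbb{S}$ let $\Psi_i^I:\mathbb{C}^n\to\mathbb{C}_I^n$, $x+yi\mapsto x+yI$ ($x,y\in\mathbb{R}^n$). Let $\mathscr{P}(\mathbb{C}^n)$ be the set of continuous paths $\gamma:[0,1]\to\mathbb{C}^n$ with $\gamma(0)\in\mathbb{R}^n$; put $\gamma^I:=\Psi_i^I\circ\gamma$, and write $\gamma^I\subset\Omega$ if $\gamma^I([0,1])\subset\Omega$.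 For $\Omega\subset\mathbb{H}_s^n$ let $\mathscr{P}(\mathbb{C}^n,\Omega):=\{\gamma\in\mathscr{P}(\mathbb{C}^n):\exists I\in\mathbb{S},\ \gamma^I\subset\Omega\}$, and for $\gamma\in\mathscr{P}(\mathbb{C}^n)$ let $\mathbb{S}(\Omega,\gamma):=\{I\in\mathbb{S}:\gamma^I\subset\Omega\}$. A function $f:\Omega\to\mathbb{H}$ is path-slice if there is a function $F:\mathscr{P}(\mathbb{C}^n,\Omega)\to\mathbb{H}^{2\times1}$ with $f(\gamma^I(1))=(1,I)F(\gamma)$ for all $\gamma\in\mathscr{P}(\mathbb{C}^n,\Omega)$ and $I\in\mathbb{S}(\Omega,\gamma)$; any such $F$ is called a path-slice stem function of $f$. $\Omega$ is real-path-connected if for every $q\in\Omega$ there are $\gamma\in\mathscr{P}(\mathbb{C}^n,\Omega)$ and $I\in\mathbb{S}(\Omega,\gamma)$ with $\gamma^I(1)=q$. For $\Omega_1,\Omega_2\subset\mathbb{H}_s^n$, $\Omega_2$ is $\Omega_1$-stem-preserving if (i) $|\mathbb{S}(\Omega_2,\gamma)|\geq 2$ for every $\gamma\in\mathscr{P}(\mathbb{C}^n,\Omega_1)$, and (ii) $|\mathbb{S}(\Omega_2,\alpha)\cap\mathbb{S}(\Omega_2,\beta)|\neq 1$ for all $\alpha,\beta\in\mathscr{P}(\mathbb{C}^n,\Omega_1)$ with $\alpha(1)=\beta(1)$. $\Omega$ is self-stem-preserving if it is real-path-connected and $\Omega$-stem-preserving. For $I\ne J$ in $\mathbb{S}$,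 the matrix $\begin{pmatrix}1&I\\1&J\end{pmatrix}$ is invertible over $\mathbb{H}$ with inverse $(I-J)^{-1}\begin{pmatrix}I&-J\\1&-1\end{pmatrix}$. *)

(* Defs.v *)
From HB Require Import structures.
From mathcomp Require Import all_boot all_order all_algebra.
From mathcomp Require Import complex ring lra.
From mathcomp Require Import all_classical all_reals all_analysis.

Set Implicit Arguments.
Unset Strict Implicit.
Unset Printing Implicit Defensive.

Import Order.TTheory GRing.Theory Num.Theory.
Import numFieldNormedType.Exports.

Local Open Scope classical_set_scope.
Local Open Scope ring_scope.

Record quat (R : Type) := Quat { q0 : R; q1 : R; q2 : R; q3 : R }.

Section Quaternions.
Variable R : realType.
Local Notation H := (quat R).
Implicit Types x y z : H.

Definition prod_of_quat x := (q0 x, q1 x, q2 x, q3 x).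
Definition quat_of_prod (p : R * R * R * R) : H :=
  let: (a, b, c, d) := p in Quat a b c d.

Lemma prod_of_quatK : cancel prod_of_quat quat_of_prod.
Proof. by case. Qed.

HB.instance Definition _ := Choice.copy H (can_type prod_of_quatK).

Definition addq x y :=
  Quat (q0 x + q0 y) (q1 x + q1 y) (q2 x + q2 y) (q3 x + q3 y).
Definition oppq x := Quat (- q0 x) (- q1 x) (- q2 x) (- q3 x).
Definition mulq x y := Quat
  (q0 x * q0 y - q1 x * q1 y - q2 x * q2 y - q3 x * q3 y)
  (q0 x * q1 y + q1 x * q0 y + q2 x * q3 y - q3 x * q2 y)
  (q0 x * q2 y - q1 x * q3 y + q2 x * q0 y + q3 x * q1 y)
  (q0 x * q3 y + q1 x * q2 y - q2 x * q1 y + q3 x * q0 y).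
Definition scaleq (a : R) x := Quat (a * q0 x) (a * q1 x) (a * q2 x) (a * q3 x).
Definition zeroq : H := Quat 0 0 0 0.
Definition oneq : H := Quat 1 0 0 0.
Definition conjq x := Quat (q0 x) (- q1 x) (- q2 x) (- q3 x).
Definition normq2 x := q0 x ^+ 2 + q1 x ^+ 2 + q2 x ^+ 2 + q3 x ^+ 2.
Definition invq x := scaleq (normq2 x)^-1 (conjq x).

Fact addqA : associative addq.
Proof. by move=> [? ? ? ?] [? ? ? ?] [? ? ? ?]; congr Quat; exact: addrA. Qed.
Fact addqC : commutative addq.
Proof. by move=> [? ? ? ?] [? ? ? ?]; congr Quat; exact: addrC. Qed.
Fact add0q : left_id zeroq addq.
Proof. by move=> [? ? ? ?]; congr Quat; exact: add0r. Qed.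
Fact addNq : left_inverse zeroq oppq addq.
Proof. by move=> [? ? ? ?]; congr Quat; exact: addNr. Qed.

HB.instance Definition _ := GRing.isZmodule.Build H addqA addqC add0q addNq.

Fact mulqA : associative mulq.
Proof. by move=> [? ? ? ?] [? ? ? ?] [? ? ? ?]; congr Quat => /=; ring. Qed.
Fact mul1q : left_id oneq mulq.
Proof. by move=> [? ? ? ?]; congr Quat => /=; ring. Qed.
Fact mulq1 : right_id oneq mulq.
Proof. by move=> [? ? ? ?]; congr Quat => /=; ring. Qed.
Fact mulqDl : left_distributive mulq addq.
Proof. by move=> [? ? ? ?] [? ? ? ?] [? ? ? ?]; congr Quat => /=; ring. Qed.
Fact mulqDr : right_distributive mulq addq.
Proof. by move=> [? ? ? ?] [? ? ? ?] [? ? ? ?]; congr Quat => /=; ring. Qed.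
Fact oneq_neq0 : oneq != 0.
Proof. by apply/eqP => -[] /eqP; rewrite oner_eq0. Qed.

HB.instance Definition _ :=
  GRing.Zmodule_isNzRing.Build H mulqA mul1q mulq1 mulqDl mulqDr oneq_neq0.

Fact scaleqA a b x : scaleq a (scaleq b x) = scaleq (a * b) x.
Proof. by case: x => ? ? ? ?; congr Quat; exact: mulrA. Qed.
Fact scale1q : left_id 1 scaleq.
Proof. by move=> [? ? ? ?]; congr Quat; exact: mul1r. Qed.
Fact scaleqDr : right_distributive scaleq +%R.
Proof. by move=> ? [? ? ? ?] [? ? ? ?]; congr Quat; exact: mulrDr. Qed.
Fact scaleqDl x : {morph scaleq^~ x : a b / a + b}.
Proof. by case: x => ? ? ? ? ? ?; congr Quat; exact: mulrDl. Qed.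

HB.instance Definition _ :=
  GRing.Zmodule_isLmodule.Build R H scaleqA scale1q scaleqDr scaleqDl.

Fact scaleqAl (a : R) x y : a *: (x * y) = a *: x * y.
Proof. by case: x y => ? ? ? ? [? ? ? ?]; congr Quat => /=; ring. Qed.
Fact scaleqAr (a : R) x y : a *: (x * y) = x * (a *: y).
Proof. by case: x y => ? ? ? ? [? ? ? ?]; congr Quat => /=; ring. Qed.

HB.instance Definition _ := GRing.Lmodule_isLalgebra.Build R H scaleqAl.
HB.instance Definition _ := GRing.Lalgebra_isAlgebra.Build R H scaleqAr.

Fact normq2_eq0 x : (normq2 x == 0) = (x == 0).
Proof.
case: x => a b c d; rewrite /normq2 /=; apply/eqP/eqP => [h|[-> -> -> ->]].
  have := (sqr_ge0 a, sqr_ge0 b, sqr_ge0 c, sqr_ge0 d).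
  move=> [[[ha hb] hc] hd].
  by congr Quat; apply/eqP; rewrite -sqrf_eq0; apply/eqP; lra.
by rewrite !expr0n /= !addr0.
Qed.

Fact mulVq : {in [pred x | x != 0], left_inverse 1 invq *%R}.
Proof.
move=> x; rewrite inE /= -normq2_eq0; case: x => a b c d.
rewrite /normq2 /= => nz; rewrite /invq /normq2 /=.
by congr Quat => /=; field.
Qed.
Fact mulqV : {in [pred x | x != 0], right_inverse 1 invq *%R}.
Proof.
move=> x; rewrite inE /= -normq2_eq0; case: x => a b c d.
rewrite /normq2 /= => nz; rewrite /invq /normq2 /=.
by congr Quat => /=; field.
Qed.
Fact quat_unitP x y : y * x = 1 /\ x * y = 1 -> [pred x | x != 0] x.
Proof.
move=> [yx _]; apply/eqP => x0; move: yx; rewrite x0 mulr0 => /esym/eqP.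
by rewrite oner_eq0.
Qed.
Fact invq_out : {in [predC [pred x | x != 0]], invq =1 id}.
Proof.
move=> x; rewrite !inE negbK => /eqP ->.
by congr Quat => /=; rewrite ?oppr0 mulr0.
Qed.

HB.instance Definition _ :=
  GRing.NzRing_hasMulInverse.Build H mulVq mulqV quat_unitP invq_out.

End Quaternions.

Section SliceCone.
Variables (R : realType) (n : nat).
Local Notation H := (quat R).

Definition imag_units : set H := [set I | I ^+ 2 = -1].

Definition slice_plane (I : H) : set H :=
  [set q | exists x y : R, q = x%:A + y *: I].

Definition slice_space (I : H) : set 'rV[H]_n :=
  [set q | forall k, slice_plane I (q 0 k)].

Definition slice_cone : set 'rV[H]_n := \bigcup_(I in imag_units) slice_space I.

(* The complex plane is written [R[i]^o] because the library puts the topology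
   of the modulus on that copy of [R[i]]; row vectors carry the product
   topology. *)
Definition complex_space := 'rV[R[i]^o]_n.

Definition real_points : set complex_space :=
  range (map_mx (real_complex R) : 'rV[R]_n -> complex_space).

Definition Psi (I : H) (z : complex_space) : 'rV[H]_n :=
  \row_k ((complex.Re (z 0 k))%:A + complex.Im (z 0 k) *: I).

End SliceCone.

Section Paths.
Variable R : realType.
Local Notation H := (quat R).

Definition unit_itv : set R := `[0, 1]%classic.

Fact unit_itv0 : (0 : R) \in unit_itv.
Proof. by apply/mem_set; rewrite /unit_itv /= in_itv /= lexx ler01. Qed.
Fact unit_itv1 : (1 : R) \in unit_itv.
Proof. by apply/mem_set; rewrite /unit_itv /= in_itv /= lexx ler01. Qed.

Definition itv_start : unit_itv := exist _ 0 unit_itv0.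
Definition itv_end : unit_itv := exist _ 1 unit_itv1.

Variable n : nat.

Record cpath := CPath {
  cpath_fun :> unit_itv -> complex_space R n;
  cpath_continuous : continuous cpath_fun;
  cpath_start : real_points (cpath_fun itv_start) }.

Definition lift_path (I : H) (g : cpath) : unit_itv -> 'rV[H]_n := Psi I \o g.

Definition units_at (Omega : set 'rV[H]_n) (g : cpath) : set H :=
  [set I | imag_units I /\ range (lift_path I g) `<=` Omega].

Definition paths_in (Omega : set 'rV[H]_n) : set cpath :=
  [set g | exists I, units_at Omega g I].

Lemma lift_path_end_mem Omega g I :
  units_at Omega g I -> lift_path I g itv_end \in Omega.
Proof. by move=> [_ sub]; apply/mem_set/sub; exists itv_end. Qed.

Definition endpoint Omega g I (hI : units_at Omega g I) : Omega :=
  exist _ (lift_path I g itv_end) (lift_path_end_mem hI).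

Definition real_path_connected (Omega : set 'rV[H]_n) :=
  forall q, Omega q -> exists2 g, paths_in Omega g &
    exists2 I, units_at Omega g I & lift_path I g itv_end = q.

(* [stem_preserving Omega1 Omega2]: [Omega2] is [Omega1]-stem-preserving. *)
Definition stem_preserving (Omega1 Omega2 : set 'rV[H]_n) :=
  (forall g, paths_in Omega1 g -> (`I_2 #<= units_at Omega2 g)%card) /\
  (forall a b, paths_in Omega1 a -> paths_in Omega1 b ->
    a itv_end = b itv_end ->
    ~ (units_at Omega2 a `&` units_at Omega2 b #= `I_1)%card).

Definition self_stem_preserving (Omega : set 'rV[H]_n) :=
  real_path_connected Omega /\ stem_preserving Omega Omega.

End Paths.

Section PathSlice.
Variable R : realType.
Local Notation H := (quat R).

Definition row2 (a b : H) : 'rV[H]_2 := \row_j (if j == 0 then a else b).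
Definition col2 (a b : H) : 'cV[H]_2 := \col_i (if i == 0 then a else b).
Definition mx22 (a b c d : H) : 'M[H]_2 :=
  \matrix_(i, j) (if i == 0 then row2 a b 0 j else row2 c d 0 j).

Definition slice_mx (I J : H) : 'M[H]_2 := mx22 1 I 1 J.

(* [invmx] needs commutative entries, so the inverse of [slice_mx I J] is
   given explicitly; [*:] multiplies all entries on the left. *)
Definition slice_mx_inv (I J : H) : 'M[H]_2 :=
  (I - J)^-1 *: mx22 I (- J) 1 (-1).

Lemma eq_mx22 (A B : 'M[H]_2) : A 0 0 = B 0 0 -> A 0 1 = B 0 1 ->
  A 1 0 = B 1 0 -> A 1 1 = B 1 1 -> A = B.
Proof.
move=> h00 h01 h10 h11; apply/matrixP => i j.
have ord2 (k : 'I_2) : k = 0 \/ k = 1.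
  by case: k => [[|[|//]]] ?; [left|right]; exact: val_inj.
by case: (ord2 i) => ->; case: (ord2 j) => ->.
Qed.

Lemma mul_mx22 (a b c d a' b' c' d' : H) :
  mx22 a b c d *m mx22 a' b' c' d' =
  mx22 (a * a' + b * c') (a * b' + b * d') (c * a' + d * c') (c * b' + d * d').
Proof. by apply: eq_mx22; rewrite !mxE !big_ord_recl big_ord0 !mxE /= addr0. Qed.

Lemma scale_mx22 (k a b c d : H) :
  k *: mx22 a b c d = mx22 (k * a) (k * b) (k * c) (k * d).
Proof. by apply: eq_mx22; rewrite !mxE. Qed.

Lemma mx22_1 : mx22 1 0 0 1 = 1%:M.
Proof. by apply: eq_mx22; rewrite !mxE. Qed.

Lemma slice_mxV (I J : H) : imag_units I -> imag_units J -> I != J ->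
  slice_mx I J *m slice_mx_inv I J = 1%:M /\
  slice_mx_inv I J *m slice_mx I J = 1%:M.
Proof.
rewrite /imag_units /= !expr2 => II JJ neIJ.
have uIJ : I - J \is a GRing.unit by rewrite unfold_in /= subr_eq0.
have IV : I * (I - J)^-1 = - ((I - J)^-1 * J).
  apply: (mulrI uIJ); rewrite mulrN !mulrA divrr // mul1r.
  apply: (mulIr uIJ); rewrite -!mulrA mulVr // mulr1 mulNr.
  by rewrite mulrBl mulrBr II JJ opprB.
have JV : J * (I - J)^-1 = - ((I - J)^-1 * I).
  apply: (mulrI uIJ); rewrite mulrN !mulrA divrr // mul1r.
  apply: (mulIr uIJ); rewrite -!mulrA mulVr // mulr1 mulNr.
  by rewrite mulrBl mulrBr II JJ opprB.
rewrite /slice_mx /slice_mx_inv scale_mx22 !mul_mx22 -mx22_1; split.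
  congr mx22; rewrite ?mul1r ?mulr1 ?mulrA ?IV ?JV ?mulrN ?mulr1 ?mulNr.
  - by rewrite -mulrBr mulVr.
  - by rewrite subrr.
  - by rewrite subrr.
  - by rewrite addrC opprK -mulrBr mulVr.
congr mx22; rewrite ?mulr1 ?mulrN ?mulr1 ?mulNr.
- by rewrite -mulrBr mulVr.
- by rewrite -!mulrA II JJ subrr.
- by rewrite subrr.
- by rewrite -mulrBr mulVr.
Qed.

Variable n : nat.
Implicit Types (Omega : set 'rV[H]_n).

Definition stem_function Omega (f : Omega -> H)
    (F : paths_in Omega -> 'cV[H]_2) :=
  forall (g : paths_in Omega) I (hI : units_at Omega (\val g) I),
    f (endpoint hI) = (row2 1 I *m F g) 0 0.

Definition path_slice Omega (f : Omega -> H) := exists F, stem_function f F.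

Definition stem_values Omega (f : Omega -> H) (g : cpath R n) : set 'cV[H]_2 :=
  [set v | exists I J (hI : units_at Omega g I) (hJ : units_at Omega g J),
     I != J /\
     v = slice_mx_inv I J *m col2 (f (endpoint hI)) (f (endpoint hJ))].

(* The formula defines a function [F] exactly when at every path it has one and
   only one value, whatever the choice of [I] and [J]. *)
Definition given_by_stem_formula Omega (f : Omega -> H)
    (F : paths_in Omega -> 'cV[H]_2) :=
  forall g : paths_in Omega, stem_values f (\val g) = [set F g].

End PathSlice.

(* Main.v *)
(** Two distinct units I, J at a path turn the stem equation into the linear
    system (f(g^I(1)), f(g^J(1))) = (1 I; 1 J) F(g). Its matrix is invertible,
    so any stem function is given by the formula, hence is unique. *)

Require Import Defs.
From mathcomp Require Import all_boot all_order all_algebra.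
From mathcomp Require Import all_classical all_reals all_analysis.

Local Open Scope classical_set_scope.

(** The injection behind the cardinal inequality sends 0 and 1 to distinct points of [A]. *)
Lemma two_le_card_distinct {T : choiceType} {A : set T} :
  (`I_2 #<= A)%card -> exists x y, [/\ A x, A y & x != y].
Proof.
move=> /card_leP[g].
have I0 : 0%N \in `I_2 by rewrite inE.
have I1 : 1%N \in `I_2 by rewrite inE.
exists (\val (g (exist _ 0%N I0))), (\val (g (exist _ 1%N I1))).
split; [exact: set_valP | exact: set_valP |].
by apply/eqP => /val_inj/(inj (in_setT _) (in_setT _)).
Qed.

(** Packs the two stem equations, at [I] and at [J], into one matrix equation. *)
Lemma slice_mx_mulE (R : realType) (I J : quat R) (v : 'cV[quat R]_2) :
  (slice_mx I J *m v = col2 ((row2 1 I *m v) 0 0) ((row2 1 J *m v) 0 0))%R.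
Proof.
apply/colP => i; rewrite !mxE.
by case: ifP => i0; rewrite ?mxE; apply: eq_bigr => j _; rewrite !mxE i0.
Qed.

Lemma stem_function_given_by_formula (R : realType) (n : nat)
  (Omega : set 'rV[quat R]_n) (f : Omega -> quat R)
  (F : paths_in Omega -> 'cV[quat R]_2) :
  (forall g, paths_in Omega g -> (`I_2 #<= units_at Omega g)%card) ->
  stem_function f F -> given_by_stem_formula f F.
Proof.
move=> card2 stemF g.
have formulaE I J (hI : units_at Omega (\val g) I)
    (hJ : units_at Omega (\val g) J) : I != J ->
    (slice_mx_inv I J *m col2 (f (endpoint hI)) (f (endpoint hJ)) = F g)%R.
  (* Both values of [f] come from the same column [F g], so a left inverse of [slice_mx I J]
     recovers it. *)
  move=> neIJ; rewrite !(stemF g) -slice_mx_mulE mulmxA.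
  by have [_ ->] := slice_mxV hI.1 hJ.1 neIJ; rewrite mul1mx.
apply/seteqP; split=> [_ [I [J [hI [hJ [neIJ ->]]]]]|_ ->]; first exact: formulaE.
(* The reverse inclusion asks that the formula have a value at all, hence two distinct units at
   [g]. *)
have [I [J [hI hJ neIJ]]] := two_le_card_distinct (card2 _ (set_valP g)).
by exists I, J, hI, hJ; split=> //; rewrite formulaE.
Qed.

Theorem theorem5p2 (R : realType) (n : nat) (n_gt0 : (0 < n)%N)
  (Omega : set 'rV[quat R]_n) (Omega_sub : Omega `<=` @slice_cone R n)
  (Omega_stem : self_stem_preserving Omega) (f : Omega -> quat R) :
  path_slice f <->
  exists F : paths_in Omega -> 'cV[quat R]_2,
    given_by_stem_formula f F /\ unique (stem_function f) F.
Proof.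
have formula G := @stem_function_given_by_formula R n Omega f G Omega_stem.2.1.
split=> [[F stemF]|[F [_ [stemF _]]]]; last by exists F.
exists F; split; first exact: formula.
split=> // G stemG; apply/funext => g.
(* Both singletons are the set of formula values at [g], which involves no stem function. *)
have : [set F g] = [set G g] by rewrite -(formula F stemF) (formula G stemG).
by move=> /seteqP[/(_ (F g) erefl)].
Qed.
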